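(* Work on $\mathbb{R}^d$ with coordinates $x^\mu$ and smooth fields (non-singular at $x=0$). The map $\omega\mapsto R$, $R^a_{\ b}=d\omega^a_{\ b}+\omega^a_{\ c}\wedge\omega^c_{\ b}$, with inverse $\omega^a_{\ b\mu}(x)=\int_0^1 t\,x^\nu R^a_{\ b\nu\mu}(tx)\,dt$, is a bijection between: (i) the space of curvature 2-forms $R^a_{\ b}$ satisfying the 1st Bianchi identity for curvature $$R^a_{\ b}\wedge e^b=0,\qquad e^a_\mu(x)=\delta^a_\mu+\int_0^1 t(1-t)\,x^b x^\nu R^a_{\ b\nu\mu}(tx)\,dt,$$ and the 2nd Bianchi identity for curvature $$dR^a_{\ b}+\omega^a_{\ c}\wedge R^c_{\ b}-R^a_{\ c}\wedge\omega^c_{\ b}=0,\qquad \omega^a_{\ b\mu}(x)=\int_0^1 t\,x^\nu R^a_{\ b\nu\mu}(tx)\,dt;$$ (ii) the space of spin-connections $\omega^a_{\ b}$ satisfying the Fock–Schwinger gauge condition $i_{\mathfrak r}\omega^a_{\ b}=0$ (i.e. $x^\mu\omega^a_{\ b\mu}(x)=0$) and the torsionless condition $$de^a+\omega^a_{\ b}\wedge e^b=0,\qquad\text{where } e^a_\mu(x)=\delta^a_\mu+\int_0^1 \omega^a_{\ b\mu}(tx)\,t\,x^b\,dt.$$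
   Context: Latin indices $a,b,c\in\{1,\dots,d\}$ are frame indices, Greek indices coordinate indices; frame indices are raised/lowered with $\delta_{ab}$, repeated indices summed, and $x^a=\delta^a_\mu x^\mu$. Curvature 2-forms $R^a_{\ b}=\tfrac12R^a_{\ b\mu\nu}dx^\mu\wedge dx^\nu$ and spin-connections $\omega^a_{\ b}=\omega^a_{\ b\mu}dx^\mu$ are $\mathfrak{so}(d)$-valued (antisymmetric in $a,b$). $e^a=e^a_\mu dx^\mu$. $\mathfrak r=x^\mu\partial_\mu$ is the radial vector field and $i_X$ the interior product, $(i_X\omega)_{\mu_2\dots\mu_p}=X^{\mu_1}\omega_{\mu_1\dots\mu_p}$. Conventions: $(d\omega)_{\mu_1\dots\mu_{p+1}}=(p+1)\partial_{[\mu_1}\omega_{\mu_2\dots\mu_{p+1}]}$, $(\omega\wedge\sigma)_{\mu_1\dots\mu_{p+q}}=\frac{(p+q)!}{p!q!}\omega_{[\mu_1\dots\mu_p}\sigma_{\mu_{p+1}\dots\mu_{p+q}]}$. *)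

(* Defs.v *)
From HB Require Import structures.
From mathcomp Require Import all_boot all_order all_algebra.
From mathcomp Require Import all_classical all_reals all_analysis.
Set Implicit Arguments. Unset Strict Implicit. Unset Printing Implicit Defensive.
Import Order.TTheory GRing.Theory Num.Theory.
Import numFieldNormedType.Exports.
Local Open Scope classical_set_scope.
Local Open Scope ring_scope.

Section Defs.
Variables (R : realType) (d : nat).

Definition field := 'rV[R]_d -> R.
(* spin connection components  w^a_{b mu}(x) : arguments a b mu *)
Definition connT := 'I_d -> 'I_d -> 'I_d -> field.
(* curvature components  R^a_{b mu nu}(x) : arguments a b mu nu *)
Definition curvT := 'I_d -> 'I_d -> 'I_d -> 'I_d -> field.

Definition coord (x : 'rV[R]_d) (mu : 'I_d) : R := x ord0 mu.

Definition pd (mu : 'I_d) (f : field) : field :=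
  fun x => derive f x (delta_mx ord0 mu : 'rV[R]_d).

Definition iter_pd (l : seq 'I_d) (f : field) : field := foldr pd f l.

Definition smooth (f : field) : Prop :=
  forall (l : seq 'I_d) (x : 'rV[R]_d), differentiable (iter_pd l f) x.

Definition int01 (g : R -> R) : R :=
  \int[lebesgue_measure]_(t in `[0%R, 1%R]) g t.

Definition kron (a mu : 'I_d) : R := if a == mu then 1 else 0.

Definition curv (w : connT) : curvT := fun a b mu nu x =>
  pd mu (w a b nu) x - pd nu (w a b mu) x
  + \sum_(c < d) (w a c mu x * w c b nu x - w a c nu x * w c b mu x).

Definition inv_map (Rc : curvT) : connT := fun a b mu x =>
  int01 (fun t => t * \sum_(nu < d) coord x nu * Rc a b nu mu (t *: x)).

Definition e_of_curv (Rc : curvT) : 'I_d -> 'I_d -> field := fun a mu x =>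
  kron a mu + int01 (fun t => t * (1 - t) *
     \sum_(b < d) \sum_(nu < d) coord x b * coord x nu * Rc a b nu mu (t *: x)).

Definition e_of_conn (w : connT) : 'I_d -> 'I_d -> field := fun a mu x =>
  kron a mu + int01 (fun t => \sum_(b < d) w a b mu (t *: x) * t * coord x b).

Definition is_so_curv (Rc : curvT) : Prop :=
  (forall a b mu nu x, Rc a b mu nu x = - Rc b a mu nu x) /\
  (forall a b mu nu x, Rc a b mu nu x = - Rc a b nu mu x) /\
  (forall a b mu nu, smooth (Rc a b mu nu)).

(* (R^a_b /\ e^b)_{mu nu rho} = 3 R^a_b[mu nu e^b rho]  (cyclic sum, R antisymmetric) *)
Definition bianchi1 (Rc : curvT) : Prop :=
  let e := e_of_curv Rc in
  forall a mu nu rho x,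
    \sum_(b < d) (Rc a b mu nu x * e b rho x + Rc a b nu rho x * e b mu x
                  + Rc a b rho mu x * e b nu x) = 0.

Definition bianchi2 (Rc : curvT) : Prop :=
  let w := inv_map Rc in
  forall a b mu nu rho x,
    pd mu (Rc a b nu rho) x + pd nu (Rc a b rho mu) x + pd rho (Rc a b mu nu) x
    + \sum_(c < d) (w a c mu x * Rc c b nu rho x + w a c nu x * Rc c b rho mu x
                    + w a c rho x * Rc c b mu nu x)
    - \sum_(c < d) (Rc a c mu nu x * w c b rho x + Rc a c nu rho x * w c b mu x
                    + Rc a c rho mu x * w c b nu x) = 0.

Definition space_i (Rc : curvT) : Prop :=
  is_so_curv Rc /\ bianchi1 Rc /\ bianchi2 Rc.

Definition is_so_conn (w : connT) : Prop :=
  (forall a b mu x, w a b mu x = - w b a mu x) /\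
  (forall a b mu, smooth (w a b mu)).

Definition fock_schwinger (w : connT) : Prop :=
  forall a b x, \sum_(mu < d) coord x mu * w a b mu x = 0.

Definition torsionless (w : connT) : Prop :=
  let e := e_of_conn w in
  forall a mu nu x,
    pd mu (e a nu) x - pd nu (e a mu) x
    + \sum_(b < d) (w a b mu x * e b nu x - w a b nu x * e b mu x) = 0.

Definition space_ii (w : connT) : Prop :=
  is_so_conn w /\ fock_schwinger w /\ torsionless w.

End Defs.

(* Main.v *)
(** In the Fock-Schwinger gauge everything is governed by the Euler operator
    [E = x^mu d_mu] and the radial integrals [K_n f (x) = int_0^1 t^n f(t x) dt],
    which invert it: [K_n (E + n + 1) = (E + n + 1) K_n = id].  If [i_r w = 0] then
    [i_r R = L_r w = (E + 1) w] on components, so [w = K_0 (i_r R)], which is the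
    inverse map.  Conversely, let [w = K_0 (i_r R)] and [D = curv w - R].  Then
    [i_r D = 0], and the second Bianchi identity for both terms gives [i_r dD = 0];
    hence [L_r D = 0], i.e. [(E + 2) D = 0], and [D = 0].  The same argument applied
    to the torsion, whose covariant derivative is [R /\ e], turns the first Bianchi
    identity into the torsionless condition. *)
Require Import Defs.
From HB Require Import structures.
From mathcomp Require Import all_boot all_order all_algebra.
From mathcomp Require Import all_classical all_reals all_analysis.
From mathcomp Require Import ring lra.
Set Implicit Arguments. Unset Strict Implicit. Unset Printing Implicit Defensive.
Import Order.TTheory GRing.Theory Num.Theory.
(* [Defs] is imported again so that [coord] is not shadowed by the one of [vector]. *)
Import numFieldNormedType.Exports Defs.
Local Open Scope classical_set_scope.
Local Open Scope ring_scope.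

(** * Smoothness and derivatives along lines *)

Section Calculus.
Variables (R : realType) (d : nat).
Implicit Types (f g : field R d) (x p v : 'rV[R]_d) (mu nu : 'I_d).

Lemma smooth_differentiable f x : smooth f -> differentiable f x.
Proof. by move=> /(_ [::] x). Qed.

Lemma smooth_continuous f : smooth f -> continuous f.
Proof. by move=> sf x; apply/differentiable_continuous/smooth_differentiable. Qed.

(** The last index of the list is differentiated first, so peeling from the right replaces [f] by
    [pd mu f]. The smoothness proofs by induction on the list rely on this. *)
Lemma iter_pd_rcons l mu f : iter_pd (rcons l mu) f = iter_pd l (pd mu f).
Proof. by rewrite /iter_pd foldr_rcons. Qed.

Lemma smooth_pd mu f : smooth f -> smooth (pd mu f).
Proof. by move=> sf l x; rewrite -iter_pd_rcons; exact: sf. Qed.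

Lemma smoothP f : (forall x, differentiable f x) ->
  (forall mu, smooth (pd mu f)) -> smooth f.
Proof.
by move=> df spf l; elim/last_ind: l => // l mu _ x; rewrite iter_pd_rcons; exact: spf.
Qed.

Lemma diff_pd f x v : differentiable f x ->
  'd f x v = \sum_nu coord v nu * pd nu f x.
Proof.
move=> df; rewrite {1}(row_sum_delta v) linear_sum; apply: eq_bigr => nu _.
by rewrite linearZ /pd deriveE.
Qed.

(** Chain rule, used with [p = t *: x] for the mean value estimate and with [p = 0] for derivatives
    along rays. *)
Lemma is_derive_line f p v (t : R) : smooth f ->
  is_derive t 1 (fun t => f (p + t *: v)) (\sum_nu coord v nu * pd nu f (p + t *: v)).
Proof.
move=> sf.
have dl : is_diff t (fun t : R => p + t *: v) (fun t : R => t *: v).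
  have h : is_diff t (cst p + *:%R^~ v) (0 + *:%R^~ v) by apply: is_diffD.
  by apply: is_diff_eq h _; apply/funext => s; rewrite /= fctE /= add0r.
have df : differentiable f (p + t *: v) by exact: smooth_differentiable.
have dfl : differentiable (f \o (fun t : R => p + t *: v)) t.
  by apply: differentiable_comp => //; exact: ex_diff.
apply: DeriveDef; first by apply/derivable1_diffP.
rewrite deriveE // diff_comp //=.
by rewrite (@diff_val _ _ _ _ _ _ _ dl) scale1r diff_pd.
Qed.

End Calculus.

(** * Algebra of smooth functions and rules for partial derivatives *)

Section SmoothAlgebra.
Variables (R : realType) (d : nat).
Implicit Types (f g : field R d) (x p : 'rV[R]_d) (mu nu : 'I_d).

Lemma smooth_derivable f x v : smooth f -> derivable f x v.
Proof. by move=> sf; exact/diff_derivable/smooth_differentiable. Qed.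

Lemma pd_cst (c : R) mu x : pd mu (fun=> c) x = 0.
Proof. exact: derive_cst. Qed.

Lemma pdD f g mu x : smooth f -> smooth g ->
  pd mu (fun y => f y + g y) x = pd mu f x + pd mu g x.
Proof. by move=> sf sg; rewrite /pd -deriveD//; exact: smooth_derivable. Qed.

Lemma pdN f mu x : smooth f -> pd mu (fun y => - f y) x = - pd mu f x.
Proof. by move=> sf; rewrite /pd -deriveN//; exact: smooth_derivable. Qed.

Lemma pdM f g mu x : smooth f -> smooth g ->
  pd mu (fun y => f y * g y) x = pd mu f x * g x + f x * pd mu g x.
Proof.
move=> sf sg; rewrite /pd deriveM; try exact: smooth_derivable.
by rewrite addrC /GRing.scale /= mulrC.
Qed.

Lemma smooth_cst (c : R) : smooth (fun _ : 'rV[R]_d => c).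
Proof.
move=> l; suff [c' ->] : exists c', iter_pd l (fun _ : 'rV[R]_d => c) = (fun=> c').
  by move=> x; exact: differentiable_cst.
elim: l => [|mu l [c' /= ->]]; first by exists c.
by exists 0; apply/funext => x; exact: pd_cst.
Qed.

Lemma pd_coord mu nu x : pd mu (fun y => coord y nu) x = kron R nu mu.
Proof.
rewrite /pd deriveE; last exact: differentiable_coord.
(* The coordinate is packaged as a linear map, so that it is its own differential. *)
have @f : {linear 'rV[R]_d -> R}.
  by exists (fun N : 'rV[R]_d => N ord0 nu); do 2![eexists]; do ?[constructor];
     rewrite ?mxE// => ? *; rewrite ?mxE//; move=> ?; rewrite !mxE.
rewrite (_ : (fun y => coord y nu) = f) // diff_lin; last exact: coord_continuous.
by rewrite /= mxE eqxx /kron; case: eqP.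
Qed.

Lemma smooth_coord nu : smooth (fun x : 'rV[R]_d => coord x nu).
Proof.
apply: smoothP => [x|mu]; first exact: differentiable_coord.
rewrite (_ : pd _ _ = fun=> kron R nu mu); first exact: smooth_cst.
by apply/funext => x; exact: pd_coord.
Qed.

Lemma smoothD f g : smooth f -> smooth g -> smooth (fun x => f x + g x).
Proof.
move=> sf sg l; elim/last_ind: l f g sf sg => [|l mu IH] f g sf sg x.
  by apply: differentiableD; exact: smooth_differentiable.
rewrite iter_pd_rcons (_ : pd mu _ = fun x => pd mu f x + pd mu g x).
  by apply: IH; exact: smooth_pd.
by apply/funext => y; exact: pdD.
Qed.

Lemma smoothN f : smooth f -> smooth (fun x => - f x).
Proof.
move=> sf l; elim/last_ind: l f sf => [|l mu IH] f sf x.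
  by apply: differentiableN; exact: smooth_differentiable.
rewrite iter_pd_rcons (_ : pd mu _ = fun x => - pd mu f x).
  by apply: IH; exact: smooth_pd.
by apply/funext => y; exact: pdN.
Qed.

Lemma smoothM f g : smooth f -> smooth g -> smooth (fun x => f x * g x).
Proof.
move=> sf sg l; have [n] := ubnP (size l).
(* Strong induction on the number of derivatives. The Leibniz rule gives a sum of two products, and
   distributing the remaining derivatives over it requires differentiability of all shorter iterated
   derivatives of each product. *)
elim: n l f g sf sg => // n IH l; case/lastP: l => [|l mu] f g sf sg.
  by move=> _ x; apply: differentiableM; exact: smooth_differentiable.
rewrite size_rcons ltnS => ln x.
pose A := fun x => pd mu f x * g x; pose B := fun x => f x * pd mu g x.
have dA : forall l', (size l' < n)%N -> forall x, differentiable (iter_pd l' A) x.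
  by move=> l' l'n; apply: IH => //; exact: smooth_pd.
have dB : forall l', (size l' < n)%N -> forall x, differentiable (iter_pd l' B) x.
  by move=> l' l'n; apply: IH => //; exact: smooth_pd.
rewrite iter_pd_rcons (_ : pd mu _ = fun x => A x + B x); last first.
  by apply/funext => y; exact: pdM.
suff -> : iter_pd l (fun x => A x + B x) = fun x => iter_pd l A x + iter_pd l B x.
  by apply: differentiableD; [exact: dA|exact: dB].
elim: l ln => //= nu l IHl ln; rewrite IHl 1?ltnW//; apply/funext => y.
by rewrite /pd -deriveD//; apply: diff_derivable; [apply: dA|apply: dB]; exact: ltnW.
Qed.

Lemma smooth_sum n (F : 'I_n -> field R d) :
  (forall i, smooth (F i)) -> smooth (fun x => \sum_i F i x).
Proof.
elim: n F => [|n IH] F sF.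
  rewrite (_ : (fun _ => _) = fun=> 0); first exact: smooth_cst.
  by apply/funext => x; rewrite big_ord0.
rewrite (_ : (fun _ => _) = fun x => \sum_i F (widen_ord (leqnSn n) i) x + F ord_max x).
  by apply: smoothD => //; exact: IH.
by apply/funext => x; rewrite big_ord_recr.
Qed.

Lemma pd_sum n (F : 'I_n -> field R d) mu x : (forall i, smooth (F i)) ->
  pd mu (fun x => \sum_i F i x) x = \sum_i pd mu (F i) x.
Proof.
move=> sF; rewrite /pd -derive_sum => [|i]; last exact: smooth_derivable.
by congr derive; apply/funext => y; rewrite fct_sumE.
Qed.

Lemma pd_translate f p mu :
  pd mu (fun x => f (x + p)) = fun x => pd mu f (x + p).
Proof.
apply/funext => x; rewrite /pd /derive; set u := (X in X @ _); set w := (X in _ = lim (X @ _)).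
by suff -> : u = w by []; apply/funext => h; rewrite /u /w /= addrA.
Qed.

Lemma smooth_translate f p : smooth f -> smooth (fun x => f (x + p)).
Proof.
move=> sf l; elim/last_ind: l f sf => [|l mu IH] f sf x /=; last first.
  by rewrite iter_pd_rcons pd_translate; apply: IH; exact: smooth_pd.
have dp : differentiable (fun y : 'rV[R]_d => y + p) x.
  by apply: differentiableD => //; exact: differentiable_cst.
by apply: (differentiable_comp dp); exact: smooth_differentiable.
Qed.

Lemma sum_kron nu (F : 'I_d -> R) : \sum_mu kron R mu nu * F mu = F nu.
Proof.
rewrite (bigD1 nu)//= /kron eqxx mul1r big1 ?addr0// => mu /negPf ->.
by rewrite mul0r.
Qed.

(** Applying [pd nu] to [x^mu F_mu = 0] gives [F_nu + x^mu d_nu F_mu = 0]. This plays the part of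
    [d i_r = 0] in Cartan's formula. *)
Lemma coord_sum_pd_of_coord_sum_eq0 (F : 'I_d -> field R d) nu x :
  (forall mu, smooth (F mu)) -> (forall y, \sum_mu coord y mu * F mu y = 0) ->
  \sum_mu coord x mu * pd nu (F mu) x = - F nu x.
Proof.
move=> sF F0; have : pd nu (fun y => \sum_mu coord y mu * F mu y) x = 0.
  by rewrite (_ : (fun y => _) = fun=> 0) ?pd_cst//; exact/funext.
rewrite pd_sum => [|mu]; last by apply: smoothM => //; exact: smooth_coord.
under eq_bigr => mu _.
  rewrite pdM//; last exact: smooth_coord.
  rewrite pd_coord; over.
rewrite big_split/= => /eqP; rewrite addrC addr_eq0 => /eqP ->; congr (- _).
exact: sum_kron.
Qed.

End SmoothAlgebra.

(** * Integration of continuous functions over the unit interval *)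

Section UnitInterval.
Variable R : realType.
Implicit Types (f g : R -> R).

Lemma integrable01 g : continuous g ->
  lebesgue_measure.-integrable `[0%R, 1%R] (EFin \o g).
Proof.
move=> cg; apply: continuous_compact_integrable; first exact: segment_compact.
exact: continuous_subspaceT.
Qed.

Lemma eq_int01 f g : (forall t, f t = g t) -> int01 f = int01 g.
Proof. by move=> fg; congr int01; exact/funext. Qed.

Lemma int01D f g : continuous f -> continuous g ->
  int01 (fun t => f t + g t) = int01 f + int01 g.
Proof. by move=> cf cg; rewrite /int01 RintegralD//; exact: integrable01. Qed.

Lemma int01B f g : continuous f -> continuous g ->
  int01 (fun t => f t - g t) = int01 f - int01 g.
Proof. by move=> cf cg; rewrite /int01 RintegralB//; exact: integrable01. Qed.

Lemma int01Z (c : R) f : continuous f -> int01 (fun t => c * f t) = c * int01 f.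
Proof. by move=> cf; rewrite /int01 RintegralZl//; exact: integrable01. Qed.

Lemma int01_cst (c : R) : int01 (fun=> c) = c.
Proof.
rewrite /int01 Rintegral_cst//= lebesgue_measure_itv/= lte_fin ltr01.
by rewrite -EFinD subr0 mulr1.
Qed.

Lemma continuous_sum n (F : 'I_n -> R -> R) :
  (forall i, continuous (F i)) -> continuous (fun t => \sum_i F i t).
Proof.
elim: n F => [|n IH] F cF t.
  rewrite (_ : (fun _ => _) = fun=> 0); first exact: cvg_cst.
  by apply/funext => s; rewrite big_ord0.
rewrite (_ : (fun _ => _) = fun s => \sum_i F (widen_ord (leqnSn n) i) s + F ord_max s).
  by apply: cvgD; [apply: IH => i|]; exact: cF.
by apply/funext => s; rewrite big_ord_recr.
Qed.

Lemma int01_sum n (F : 'I_n -> R -> R) : (forall i, continuous (F i)) ->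
  int01 (fun t => \sum_i F i t) = \sum_i int01 (F i).
Proof.
elim: n F => [|n IH] F cF.
  by rewrite big_ord0 -[RHS](int01_cst 0); apply: eq_int01 => t; rewrite big_ord0.
rewrite big_ord_recr/= -IH// -int01D//; last exact: continuous_sum.
by apply: eq_int01 => t; rewrite big_ord_recr.
Qed.

Lemma normr_int01_le f (c : R) : continuous f ->
  (forall t, 0 <= t <= 1 -> `|f t| <= c) -> `|int01 f| <= c.
Proof.
move=> cf fc; rewrite -[leRHS]int01_cst /int01.
apply: le_trans (le_normr_Rintegral _ (integrable01 cf)) _ => //.
apply: le_Rintegral => //=.
- by apply: integrable01 => t; apply: cvg_norm; exact: cf.
- by apply: integrable01 => t; exact: cvg_cst.
Qed.

Lemma int01_is_derive F f : continuous f ->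
  (forall t : R, is_derive t 1 F (f t)) -> int01 f = F 1 - F 0.
Proof.
move=> cf dF; rewrite /int01 /Rintegral.
have cF : continuous F.
  move=> t; apply: differentiable_continuous.
  by apply/derivable1_diffP; exact: ex_derive.
rewrite (@continuous_FTC2 _ _ F)//; first exact: continuous_subspaceT.
- split; last exact/cvg_at_left_filter/cF.
    by move=> t _; exact: ex_derive.
  exact/cvg_at_right_filter/cF.
- by move=> t _; rewrite derive1E derive_val.
Qed.

End UnitInterval.

(** The epsilon form of the Fréchet derivative, which is what estimates under the integral sign
    deliver. *)
Lemma is_diff_near (R : realType) (V W : normedModType R) (f : V -> W)
    (L : {linear V -> W}) x : continuous L ->
    (forall e : R, 0 < e ->
       \forall h \near (0 : V), `|f (h + x) - (f x + L h)| <= e * `|h|) ->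
  is_diff x f L.
Proof.
move=> cL fL.
have E : f \o shift x = cst (f x) + L +o_ (0 : V) id.
  by apply/eqaddoP => e /fL; apply: filterS => h; rewrite !fctE.
have dL := diff_unique cL E.
apply: DiffDef => //; apply/diff_locallyP; split; by rewrite dL.
Qed.

(** * Radial integrals, differentiation under the integral sign, and the Euler operator *)

Section RadialIntegral.
Variables (R : realType) (d : nat).
Implicit Types (f g : field R d) (x p v h : 'rV[R]_d) (mu nu : 'I_d) (n : nat).

(** The exponent is a parameter because each derivative in [x] brings out one more factor [t]: the
    whole family, not a single member, is closed under differentiation. *)
Definition radial_int n f : field R d := fun x => int01 (fun t => t ^+ n * f (t *: x)).

Lemma continuous_radial n f x : smooth f ->
  continuous (fun t : R => t ^+ n * f (t *: x)).
Proof.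
move=> sf t; apply: cvgM; first exact: exprn_continuous.
apply: (@continuous_comp _ _ _ (fun t : R => t *: x) f).
  exact: scalel_continuous.
exact: smooth_continuous.
Qed.

Lemma normr_coord_le x nu : `|coord x nu| <= `|x|.
Proof.
rewrite /coord [`|x|]mx_normrE.
exact: (@le_bigmax _ _ _ _ (fun ij : 'I_1 * 'I_d => `|x ij.1 ij.2|) (ord0, nu)).
Qed.

Lemma uniformly_continuous_ray f x (e : R) : continuous f -> 0 < e ->
  \forall h \near (0 : 'rV[R]_d), forall t, 0 <= t <= 1 ->
    `|f (t *: x + h) - f (t *: x)| <= e.
Proof.
move=> cf e0.
pose P h (t : R) := `|f (t *: x + h) - f (t *: x)| <= e.
suff H : \forall h \near (0 : 'rV[R]_d), `[0%R, 1%R]%classic `<=` P h.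
  by apply: filterS H => h Ph t t01; apply: Ph; rewrite /= in_itv.
have key (t : R) : \forall s \near t & h \near (0 : 'rV[R]_d), P h s.
  have c0 : (fun th : R * 'rV[R]_d => th.1 *: x) @ nbhs (t, (0 : 'rV[R]_d)) --> t *: x.
    by apply: cvgZr_tmp; exact: cvg_fst.
  have c1 : (fun th : R * 'rV[R]_d => th.1 *: x + th.2) @ nbhs (t, (0 : 'rV[R]_d))
      --> t *: x + 0.
    by apply: cvgD => //; exact: cvg_snd.
  have ct := cvg_comp _ _ c1 (cf _); have ct0 := cvg_comp _ _ c0 (cf _).
  rewrite addr0 in ct.
  have FF : Filter (nbhs (t, (0 : 'rV[R]_d))) by exact: nbhs_filter.
  have /cvgrPdist_le/(_ _ e0) := cvgB (FF := FF) ct ct0.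
  by rewrite subrr; apply: filterS => -[s h] /=; rewrite sub0r normrN.
(* Compactness of the segment turns the neighbourhoods of [key], joint in [t] and [h], into one
   neighbourhood of 0 valid for every [t]. *)
have /compact_near_coveringP cK := @segment_compact R 0 1.
by apply: (cK _ (nbhs (0 : 'rV[R]_d)) P) => t _; exact: key.
Qed.

(** The mean value theorem for [s |-> f (t *: x + s *: (t *: h))] on the unit interval evaluates the
    gradient at a displacement [c *: (t *: h)] of norm at most that of [h]. Each of the [d] summands
    then differs from the linear term by at most [e * |h|]. *)
Lemma radial_increment_le f x h (t e : R) : smooth f -> 0 <= t <= 1 ->
  (forall k nu, `|k| <= `|h| -> `|pd nu f (t *: x + k) - pd nu f (t *: x)| <= e) ->
  `|f (t *: (x + h)) - f (t *: x) - \sum_nu coord h nu * (t * pd nu f (t *: x))|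
    <= e * d%:R * `|h|.
Proof.
move=> sf t01 He.
have dl := fun s : R => is_derive_line (t *: x) (t *: h) s sf.
have [|c c01] := @MVT R _ _ 0 1 ltr01 (fun s _ => dl s).
  apply: continuous_subspaceT => s; apply: differentiable_continuous.
  by apply/derivable1_diffP; exact: ex_derive.
rewrite scale1r scale0r addr0 subr0 mulr1 -scalerDr => ->.
rewrite -sumrB; apply: (le_trans (ler_norm_sum _ _ _)).
rewrite mulrAC mulr_natr -[X in _ *+ X]card_ord -sumr_const.
apply: ler_sum => nu _.
rewrite (_ : coord (t *: h) nu = coord h nu * t); last by rewrite /coord mxE mulrC.
rewrite -mulrA -mulrBr -mulrBr !normrM mulrA mulrC.
have [t0 t1] := andP t01.
apply: ler_pM => //; last first.
  rewrite -[leRHS]mulr1; apply: ler_pM => //; first exact: normr_coord_le.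
  by rewrite ger0_norm.
apply: He; rewrite !normrZ mulrA -[leRHS]mul1r; apply: ler_wpM2r => //.
rewrite (ger0_norm t0) -[leRHS]mulr1; apply: ler_pM => //.
by move: c01; rewrite in_itv/= => /andP[c0 c1]; rewrite ger0_norm ltW.
Qed.

(** Differentiation under the integral sign: the candidate differential is itself written as an
    integral, and the remainder is bounded uniformly in [t] by [radial_increment_le]. *)
Lemma is_diff_radial_int n f x : smooth f ->
  is_diff x (radial_int n f)
    (fun h => \sum_nu coord h nu * radial_int n.+1 (pd nu f) x).
Proof.
move=> sf.
pose l h := \sum_nu coord h nu * radial_int n.+1 (pd nu f) x.
have lL : linear l.
  move=> k u w; rewrite /l scaler_sumr -big_split; apply: eq_bigr => nu _ /=.
  by rewrite /coord !mxE mulrDl /GRing.scale/= mulrA.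
pose lM := GRing.isLinear.Build _ _ _ _ _ lL.
pose L : {linear 'rV[R]_d -> R} := HB.pack l lM.
have cL : continuous L.
  have -> : (L : 'rV[R]_d -> R) = \sum_nu (fun h => coord h nu * radial_int n.+1 (pd nu f) x).
    by apply/funext => h; rewrite fct_sumE.
  move=> h; apply: differentiable_continuous; apply: differentiable_sum => nu.
  by apply: differentiableM; [exact: differentiable_coord|exact: differentiable_cst].
apply: (@is_diff_near _ _ _ _ L) => // e e0.
(* The estimate costs a factor [d]; dividing by [d.+1] also covers [d = 0]. *)
pose e' := e / d.+1%:R.
have e'0 : 0 < e' by rewrite divr_gt0.
have H nu : \forall h \near (0 : 'rV[R]_d), forall t, 0 <= t <= 1 ->
    `|pd nu f (t *: x + h) - pd nu f (t *: x)| <= e'.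
  apply: uniformly_continuous_ray => //.
  exact/smooth_continuous/smooth_pd.
have /nbhs_normP[r r0 Hr] := filter_forall (nbhs_filter (0 : 'rV[R]_d)) H.
apply/nbhs_normP; exists r => // h.
rewrite /ball_/= sub0r normrN => hr.
rewrite /radial_int /L/=.
have -> : l h = int01 (fun t => \sum_nu coord h nu * (t ^+ n.+1 * pd nu f (t *: x))).
  rewrite int01_sum => [|nu].
    apply: eq_bigr => nu _; rewrite int01Z//.
    exact/continuous_radial/smooth_pd.
  move=> t; apply: cvgM; first exact: cvg_cst.
  exact/continuous_radial/smooth_pd.
have cr u := @continuous_radial n f u sf.
have cB : continuous (fun t : R => t ^+ n * f (t *: (h + x)) - t ^+ n * f (t *: x)).
  by move=> t; apply: cvgB; exact: cr.
have cS : continuous (fun t : R => \sum_nu coord h nu * (t ^+ n.+1 * pd nu f (t *: x))).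
  apply: continuous_sum => nu t; apply: cvgM; first exact: cvg_cst.
  exact/continuous_radial/smooth_pd.
rewrite opprD addrA -int01B// -int01B//.
apply: normr_int01_le => [t|t t01]; first by apply: cvgB; [exact: cB|exact: cS].
have [t0 t1] := andP t01.
rewrite (_ : _ - _ = t ^+ n * (f (t *: (x + h)) - f (t *: x)
    - \sum_nu coord h nu * (t * pd nu f (t *: x)))); last first.
  rewrite !mulrBr [h + x]addrC; congr (_ - _); rewrite mulr_sumr.
  by apply: eq_bigr => nu _; rewrite exprSr -mulrA mulrCA.
rewrite normrM; apply: (@le_trans _ _ (1 * (e' * d%:R * `|h|))).
  apply: ler_pM => //; first by rewrite normrX ger0_norm// exprn_ile1.
  apply: radial_increment_le => // k nu kh; apply: Hr => //.
  by rewrite /ball_/= sub0r normrN; exact: le_lt_trans kh hr.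
rewrite mul1r; apply: ler_wpM2r => //.
rewrite /e' mulrAC ler_pdivrMr//; apply: ler_wpM2l; first exact: ltW.
by rewrite ler_nat.
Qed.

Lemma pd_radial_int n f mu :
  smooth f -> pd mu (radial_int n f) = radial_int n.+1 (pd mu f).
Proof.
move=> sf; apply/funext => x; have dr := is_diff_radial_int n x sf.
rewrite {1}/pd deriveE; last exact: ex_diff.
rewrite diff_val -[RHS](sum_kron mu (fun nu => radial_int n.+1 (pd nu f) x)).
by apply: eq_bigr => nu _; rewrite /coord mxE eqxx /kron; case: eqP.
Qed.

Lemma smooth_radial_int n f : smooth f -> smooth (radial_int n f).
Proof.
move=> sf l; elim/last_ind: l n f sf => [|l mu IH] n f sf x.
  by have := is_diff_radial_int n x sf => ?; exact: ex_diff.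
by rewrite iter_pd_rcons pd_radial_int//; apply: IH; exact: smooth_pd.
Qed.

Lemma radial_intD n f g x : smooth f -> smooth g ->
  radial_int n (fun y => f y + g y) x = radial_int n f x + radial_int n g x.
Proof.
move=> sf sg; rewrite /radial_int -int01D; try exact: continuous_radial.
by apply: eq_int01 => t; rewrite mulrDr.
Qed.

Lemma radial_intB n f g x : smooth f -> smooth g ->
  radial_int n (fun y => f y - g y) x = radial_int n f x - radial_int n g x.
Proof.
move=> sf sg; rewrite /radial_int -int01B; try exact: continuous_radial.
by apply: eq_int01 => t; rewrite mulrBr.
Qed.

Lemma radial_intZ n (c : R) f x : smooth f ->
  radial_int n (fun y => c * f y) x = c * radial_int n f x.
Proof.
move=> sf; rewrite /radial_int -int01Z; last exact: continuous_radial.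
by apply: eq_int01 => t; rewrite mulrCA.
Qed.

Lemma radial_int_sum n m (F : 'I_m -> field R d) x : (forall i, smooth (F i)) ->
  radial_int n (fun y => \sum_i F i y) x = \sum_i radial_int n (F i) x.
Proof.
move=> sF; rewrite /radial_int -int01_sum; last by move=> i; exact: continuous_radial.
by apply: eq_int01 => t; rewrite mulr_sumr.
Qed.

Lemma radial_int_coordM n f nu x : smooth f ->
  radial_int n (fun y => coord y nu * f y) x = coord x nu * radial_int n.+1 f x.
Proof.
move=> sf; rewrite /radial_int -int01Z; last exact: continuous_radial.
by apply: eq_int01 => t; rewrite /coord mxE exprSr; ring.
Qed.

Definition euler f : field R d := fun x => \sum_nu coord x nu * pd nu f x.

Lemma smooth_euler f : smooth f -> smooth (euler f).
Proof.
move=> sf; apply: smooth_sum => nu.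
by apply: smoothM; [exact: smooth_coord|exact: smooth_pd].
Qed.

(** The integrand is the derivative of [t^(n+1) f(t x)], whose value at [t = 0] vanishes because the
    exponent is positive. *)
Lemma radial_int_euler n f x : smooth f ->
  radial_int n (fun y => euler f y + n.+1%:R * f y) x = f x.
Proof.
move=> sf.
have sg : smooth (fun y => euler f y + n.+1%:R * f y).
  apply: smoothD; first exact: smooth_euler.
  by apply: smoothM => //; exact: smooth_cst.
have dF (t : R) : is_derive t 1 (fun t : R => t ^+ n.+1 * f (t *: x))
    (t ^+ n * (euler f (t *: x) + n.+1%:R * f (t *: x))).
  have := is_derive_line 0 x t sf.
  rewrite add0r (_ : (fun s : R => f (0 + s *: x)) = fun s => f (s *: x)); last first.
    by apply/funext => s; rewrite add0r.
  move=> df; have dX := is_deriveX n.+1 (is_derive_id t (1 : R)).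
  have := is_deriveM dX df; rewrite exprfctE /= => dXf.
  apply: (is_derive_eq dXf).
  rewrite /GRing.scale/= /euler mulrDr; congr (_ + _); last by ring.
  rewrite exprSr -mulrA; congr (_ * _); rewrite mulr_sumr.
  by apply: eq_bigr => nu _; rewrite /coord mxE mulrA.
have cg := @continuous_radial n _ x sg.
rewrite /radial_int (int01_is_derive cg dF).
by rewrite expr1n mul1r scale1r exprS !mul0r subr0.
Qed.

(** The Euler operator commutes with [radial_int n]: [pd] raises the exponent by one, and moving
    [coord] back under the integral lowers it again. So this reduces to [radial_int_euler]. *)
Lemma euler_radial_int n f x : smooth f ->
  euler (radial_int n f) x + n.+1%:R * radial_int n f x = f x.
Proof.
move=> sf; rewrite -[RHS](radial_int_euler n x sf) radial_intD; first last.
- by apply: smoothM => //; exact: smooth_cst.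
- exact: smooth_euler.
rewrite radial_intZ// /euler radial_int_sum => [|nu]; last first.
  by apply: smoothM; [exact: smooth_coord|exact: smooth_pd].
congr (_ + _); apply: eq_bigr => nu _.
by rewrite pd_radial_int// radial_int_coordM//; exact: smooth_pd.
Qed.

Lemma euler_coordM f nu x : smooth f ->
  euler (fun y => coord y nu * f y) x = coord x nu * (euler f x + f x).
Proof.
move=> sf; rewrite /euler.
under eq_bigr => mu _.
  rewrite pdM//; last exact: smooth_coord.
  rewrite pd_coord mulrDr; over.
rewrite big_split /= addrC mulrDr mulr_sumr; congr (_ + _).
  by apply: eq_bigr => mu _; rewrite mulrCA.
rewrite -[RHS](sum_kron nu (fun mu => coord x mu * f x)); apply: eq_bigr => mu _.
by rewrite /kron eq_sym mulrCA.
Qed.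

End RadialIntegral.

(** * Uniqueness for Euler equations, symmetry of second derivatives, and radial vanishing of
    2-forms *)

Section Vanishing.
Variables (R : realType) (d : nat).
Implicit Types (f g : field R d) (x p : 'rV[R]_d) (mu nu : 'I_d).

Lemma euler_cst (c : R) x : euler (fun=> c) x = 0.
Proof. by rewrite /euler big1// => nu _; rewrite pd_cst mulr0. Qed.

Lemma radial_int_inj0 n f x : smooth f -> (forall y, radial_int n f y = 0) -> f x = 0.
Proof.
move=> sf f0; rewrite -(euler_radial_int n x sf) f0 mulr0 addr0.
by rewrite (_ : radial_int n f = fun=> 0) ?euler_cst//; exact/funext.
Qed.

(** A solution is homogeneous of degree [-(n+1)], so smoothness at the origin forces it to
    vanish. *)
Lemma euler_eigen_eq0 n f x : smooth f ->
  (forall y, euler f y + n.+1%:R * f y = 0) -> f x = 0.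
Proof.
move=> sf f0; rewrite -(radial_int_euler n x sf) /radial_int -[RHS](int01_cst 0).
by apply: eq_int01 => t; rewrite f0 mulr0.
Qed.

Lemma pd_euler mu f x : smooth f ->
  pd mu (euler f) x = \sum_nu coord x nu * pd mu (pd nu f) x + pd mu f x.
Proof.
move=> sf; rewrite /euler pd_sum => [|nu]; last first.
  by apply: smoothM; [exact: smooth_coord|exact: smooth_pd].
under eq_bigr => nu _.
  rewrite pdM; [|exact: smooth_coord|exact: smooth_pd].
  rewrite pd_coord addrC; over.
by rewrite big_split/=; congr (_ + _); rewrite -[RHS](sum_kron mu (fun nu => pd nu f x)).
Qed.

(* Apply [d_mu] to [f = K_0 (E f + f)] and compare with [K_1 ((E + 2) d_mu f) = d_mu f]:
   the difference is [K_1] of the sum below, and [K_1] is injective. *)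
Lemma coord_sum_pd_comm mu f x : smooth f ->
  \sum_nu coord x nu * (pd mu (pd nu f) x - pd nu (pd mu f) x) = 0.
Proof.
move=> sf.
have s2 a b : smooth (pd a (pd b f)) by do 2!apply: smooth_pd.
have sA : smooth (fun y => \sum_nu coord y nu * pd mu (pd nu f) y).
  by apply: smooth_sum => nu; apply: smoothM => //; exact: smooth_coord.
have sE := smooth_euler (smooth_pd mu sf).
pose g y := \sum_nu coord y nu * pd mu (pd nu f) y - euler (pd mu f) y.
have sg : smooth g by apply: smoothD => //; exact: smoothN.
transitivity (g x).
  by rewrite /g /euler -sumrB; apply: eq_bigr => nu _; rewrite mulrBr.
apply: (@radial_int_inj0 1) => // y.
have sf1 : smooth (fun y => euler f y + 1%:R * f y).
  by apply: smoothD; [exact: smooth_euler|apply: smoothM => //; exact: smooth_cst].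
have e1 : pd mu f y = radial_int 1 (pd mu (fun y => euler f y + 1%:R * f y)) y.
  rewrite -pd_radial_int// (_ : radial_int 0 _ = f)//.
  by apply/funext => z; exact: radial_int_euler.
have s2f : smooth (fun y => 2%:R * pd mu f y).
  by apply: smoothM; [exact: smooth_cst|exact: smooth_pd].
have e2 := radial_int_euler 1 y (smooth_pd mu sf).
apply: (addIr (radial_int 1 (fun y => euler (pd mu f) y + 2%:R * pd mu f y) y)).
rewrite -radial_intD//; last exact: smoothD.
rewrite add0r e2 e1; congr radial_int; apply/funext => z.
rewrite pdD; [|exact: smooth_euler|by apply: smoothM => //; exact: smooth_cst].
rewrite pd_euler// pdM//; last exact: smooth_cst.
by rewrite pd_cst /g; ring.
Qed.

(* The previous identity holds around every centre [p]; take [x - p] to be the [nu]-th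
   basis vector. *)
Lemma pd_comm mu nu f x : smooth f -> pd mu (pd nu f) x = pd nu (pd mu f) x.
Proof.
move=> sf; pose e : 'rV[R]_d := delta_mx ord0 nu; pose p := x - e.
have := coord_sum_pd_comm mu e (smooth_translate p sf).
under eq_bigr => k _ do rewrite !pd_translate [e + p]addrC subrK.
move=> h; apply: subr0_eq; rewrite -[RHS]h.
rewrite -[LHS](sum_kron nu (fun k => pd mu (pd k f) x - pd k (pd mu f) x)).
by apply: eq_bigr => k _; rewrite /coord mxE eqxx /kron; case: eqP.
Qed.

(** Cartan's formula [L_r = d i_r + i_r d] gives [L_r D = 0], and on components of a 2-form [L_r] is
    [E + 2]. The 2 arises from the two terms whose derivative index is not contracted: each
    contributes [- D nu mu = D mu nu]. *)
Lemma radial_closed_eq0 (D : 'I_d -> 'I_d -> field R d) mu nu x :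
  (forall mu nu, smooth (D mu nu)) ->
  (forall mu nu y, D mu nu y = - D nu mu y) ->
  (forall nu y, \sum_mu coord y mu * D mu nu y = 0) ->
  (forall mu nu y, \sum_rho coord y rho *
    (pd rho (D mu nu) y + pd mu (D nu rho) y + pd nu (D rho mu) y) = 0) ->
  D mu nu x = 0.
Proof.
move=> sD aD rD cD; apply: (@euler_eigen_eq0 1) => // y.
rewrite -[RHS](cD mu nu y).
under [in RHS]eq_bigr do rewrite !mulrDr.
rewrite !big_split/= -addrA; congr (_ + _).
rewrite !coord_sum_pd_of_coord_sum_eq0//; last first.
  move=> z; transitivity (- \sum_rho coord z rho * D rho nu z); last by rewrite rD oppr0.
  rewrite -sumrN.
  by apply: eq_bigr => rho _; rewrite aD mulrN.
by rewrite (aD nu mu); ring.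
Qed.

(** Curvature and torsion are both a curl plus a sum of antisymmetrized products; this form serves
    the two of them. *)
Lemma pd_curl (u v : field R d) (f g f' g' : 'I_d -> field R d) mu nu rho x :
  smooth u -> smooth v -> (forall c, smooth (f c)) -> (forall c, smooth (g c)) ->
  (forall c, smooth (f' c)) -> (forall c, smooth (g' c)) ->
  pd rho (fun y => pd mu u y - pd nu v y
    + \sum_(c < d) (f c y * g c y - f' c y * g' c y)) x =
  pd rho (pd mu u) x - pd rho (pd nu v) x +
  \sum_(c < d) (pd rho (f c) x * g c x + f c x * pd rho (g c) x
              - (pd rho (f' c) x * g' c x + f' c x * pd rho (g' c) x)).
Proof.
move=> su sv sf sg sf' sg'.
have s1 := smooth_pd mu su; have s2 := smooth_pd nu sv; have s2' := smoothN s2.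
have sp c : smooth (fun y => f c y * g c y - f' c y * g' c y).
  by apply: smoothD; [|apply: smoothN]; exact: smoothM.
rewrite pdD; [|exact: smoothD|exact: smooth_sum].
rewrite pdD// pdN// pd_sum//; congr (_ + _); apply: eq_bigr => c _.
have m1 := smoothM (sf c) (sg c); have m2 := smoothM (sf' c) (sg' c).
by rewrite pdD//; [rewrite pdN// !pdM|exact: smoothN].
Qed.

End Vanishing.

(** * Second Bianchi identity for the curvature of a connection *)

Section CartanStructure.
Variables (R : realType) (d : nat).
Variables (w : connT R d).
Hypothesis sw : forall a b mu, smooth (w a b mu).
Implicit Types (x : 'rV[R]_d) (a b c mu nu rho : 'I_d).

Lemma smooth_curv a b mu nu : smooth (curv w a b mu nu).
Proof.
apply: smoothD; last first.
  by apply: smooth_sum => c; apply: smoothD; [|apply: smoothN]; exact: smoothM.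
by apply: smoothD; [|apply: smoothN]; exact: smooth_pd.
Qed.

Lemma curv_antisym mu nu a b x : curv w a b mu nu x = - curv w a b nu mu x.
Proof.
by rewrite /curv opprD opprB -sumrN; congr (_ + _); apply: eq_bigr => c _; ring.
Qed.

Lemma pd_curv a b mu nu rho x : pd rho (curv w a b mu nu) x =
  pd rho (pd mu (w a b nu)) x - pd rho (pd nu (w a b mu)) x +
  \sum_(c < d) (pd rho (w a c mu) x * w c b nu x + w a c mu x * pd rho (w c b nu) x
    - (pd rho (w a c nu) x * w c b mu x + w a c nu x * pd rho (w c b mu) x)).
Proof. exact: pd_curl. Qed.

(** The covariant exterior derivative [dR + w /\ R - R /\ w] for a free [w]; at [w = inv_map Rc] its
    vanishing is [bianchi2]. *)
Definition cov_ext (Rc : curvT R d) a b mu nu rho x :=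
  pd mu (Rc a b nu rho) x + pd nu (Rc a b rho mu) x + pd rho (Rc a b mu nu) x
  + \sum_(c < d) (w a c mu x * Rc c b nu rho x + w a c nu x * Rc c b rho mu x
                  + w a c rho x * Rc c b mu nu x)
  - \sum_(c < d) (Rc a c mu nu x * w c b rho x + Rc a c nu rho x * w c b mu x
                  + Rc a c rho mu x * w c b nu x).

(** [ddw] vanishes by symmetry of second derivatives, the terms with one derivative cancel against
    [d(w /\ w)], and the cubic terms cancel by associativity of the matrix product. *)
Lemma cov_ext_curv a b mu nu rho x : cov_ext (curv w) a b mu nu rho x = 0.
Proof.
(* A component of the product of three connection matrices. [TL] and [TR] express both bracketings
   through it, so that the cubic terms become common atoms. *)
pose T m n r := \sum_(c < d) \sum_(e < d) w a c m x * w c e n x * w e b r x.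
have TL m n r : \sum_(c < d) w a c m x * (\sum_(e < d) (w c e n x * w e b r x
    - w c e r x * w e b n x)) = T m n r - T m r n.
  rewrite /T -sumrB; apply: eq_bigr => c _; rewrite mulr_sumr -sumrB.
  by apply: eq_bigr => e _; ring.
have TR m n r : \sum_(c < d) (\sum_(e < d) (w a e m x * w e c n x
    - w a e n x * w e c m x)) * w c b r x = T m n r - T n m r.
  rewrite /T [X in _ = X - _]exchange_big [X in _ = _ - X]exchange_big/= -sumrB.
  apply: eq_bigr => c _.
  rewrite mulr_suml -sumrB.
  by apply: eq_bigr => e _; ring.
clearbody T.
have SL : \sum_(c < d) (w a c mu x * curv w c b nu rho x + w a c nu x * curv w c b rho mu x
      + w a c rho x * curv w c b mu nu x) =
    \sum_(c < d) (w a c mu x * (pd nu (w c b rho) x - pd rho (w c b nu) x)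
      + w a c nu x * (pd rho (w c b mu) x - pd mu (w c b rho) x)
      + w a c rho x * (pd mu (w c b nu) x - pd nu (w c b mu) x))
    + ((T mu nu rho - T mu rho nu) + (T nu rho mu - T nu mu rho)
      + (T rho mu nu - T rho nu mu)).
  rewrite -!TL -!big_split; apply: eq_bigr => c _ /=.
  (* [pd] is generalized because [ring] would otherwise unfold it to compare atoms. *)
  by rewrite /curv; move: (@pd R d) => D; ring.
have SR : \sum_(c < d) (curv w a c mu nu x * w c b rho x + curv w a c nu rho x * w c b mu x
      + curv w a c rho mu x * w c b nu x) =
    \sum_(c < d) ((pd mu (w a c nu) x - pd nu (w a c mu) x) * w c b rho x
      + (pd nu (w a c rho) x - pd rho (w a c nu) x) * w c b mu x
      + (pd rho (w a c mu) x - pd mu (w a c rho) x) * w c b nu x)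
    + ((T mu nu rho - T nu mu rho) + (T nu rho mu - T rho nu mu)
      + (T rho mu nu - T mu rho nu)).
  rewrite -!TR -!big_split; apply: eq_bigr => c _ /=.
  by rewrite /curv; move: (@pd R d) => D; ring.
rewrite /cov_ext SL SR !pd_curv.
rewrite (pd_comm nu mu)// (pd_comm rho mu)// (pd_comm rho nu)//.
set S1 := \sum_(c < d) _; set S2 := \sum_(c < d) _; set S3 := \sum_(c < d) _.
set S4 := \sum_(c < d) _; set S5 := \sum_(c < d) _.
have : S1 + S2 + S3 + S4 - S5 = 0.
  rewrite -!big_split -sumrB big1// => c _ /=.
  by move: (@pd R d) => D; ring.
clearbody S1 S2 S3 S4 S5; move: (@pd R d) => D S0.
by rewrite -[RHS]S0; ring.
Qed.

End CartanStructure.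

(** * Covariant derivative of the torsion *)

Section Torsion.
Variables (R : realType) (d : nat).
Variables (w : connT R d) (e : 'I_d -> 'I_d -> field R d).
Hypothesis sw : forall a b mu, smooth (w a b mu).
Hypothesis se : forall a mu, smooth (e a mu).
Implicit Types (x : 'rV[R]_d) (a b c mu nu rho : 'I_d).

(** Taken for any frame [e]; for [e_of_conn w] its vanishing is [torsionless]. *)
Definition torsion a mu nu : field R d := fun x =>
  pd mu (e a nu) x - pd nu (e a mu) x
  + \sum_(b < d) (w a b mu x * e b nu x - w a b nu x * e b mu x).

Lemma smooth_torsion a mu nu : smooth (torsion a mu nu).
Proof.
apply: smoothD; last first.
  by apply: smooth_sum => c; apply: smoothD; [|apply: smoothN]; exact: smoothM.
by apply: smoothD; [|apply: smoothN]; exact: smooth_pd.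
Qed.

Lemma torsion_antisym a mu nu x : torsion a mu nu x = - torsion a nu mu x.
Proof.
by rewrite /torsion opprD opprB -sumrN; congr (_ + _); apply: eq_bigr => c _; ring.
Qed.

Lemma pd_torsion a mu nu rho x : pd rho (torsion a mu nu) x =
  pd rho (pd mu (e a nu)) x - pd rho (pd nu (e a mu)) x +
  \sum_(b < d) (pd rho (w a b mu) x * e b nu x + w a b mu x * pd rho (e b nu) x
    - (pd rho (w a b nu) x * e b mu x + w a b nu x * pd rho (e b mu) x)).
Proof. exact: pd_curl. Qed.

(** With [T = de + w /\ e], [dT] gives [dw /\ e - w /\ de] and [w /\ T] gives
    [w /\ de + w /\ w /\ e]. What remains is [(dw + w /\ w) /\ e]. *)
Lemma cov_ext_torsion a mu nu rho x :
  pd mu (torsion a nu rho) x + pd nu (torsion a rho mu) x + pd rho (torsion a mu nu) x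
  + \sum_(b < d) (w a b mu x * torsion b nu rho x + w a b nu x * torsion b rho mu x
                  + w a b rho x * torsion b mu nu x)
  = \sum_(b < d) (curv w a b mu nu x * e b rho x + curv w a b nu rho x * e b mu x
                  + curv w a b rho mu x * e b nu x).
Proof.
pose T m n r := \sum_(b < d) \sum_(c < d) w a b m x * w b c n x * e c r x.
have TL m n r : \sum_(b < d) w a b m x * (\sum_(c < d) (w b c n x * e c r x
    - w b c r x * e c n x)) = T m n r - T m r n.
  rewrite /T -sumrB; apply: eq_bigr => b _; rewrite mulr_sumr -sumrB.
  by apply: eq_bigr => c _; ring.
have TR m n r : \sum_(b < d) (\sum_(c < d) (w a c m x * w c b n x
    - w a c n x * w c b m x)) * e b r x = T m n r - T n m r.
  rewrite /T [X in _ = X - _]exchange_big [X in _ = _ - X]exchange_big/= -sumrB.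
  apply: eq_bigr => b _; rewrite mulr_suml -sumrB.
  by apply: eq_bigr => c _; ring.
clearbody T.
have SL : \sum_(b < d) (w a b mu x * torsion b nu rho x + w a b nu x * torsion b rho mu x
      + w a b rho x * torsion b mu nu x) =
    \sum_(b < d) (w a b mu x * (pd nu (e b rho) x - pd rho (e b nu) x)
      + w a b nu x * (pd rho (e b mu) x - pd mu (e b rho) x)
      + w a b rho x * (pd mu (e b nu) x - pd nu (e b mu) x))
    + ((T mu nu rho - T mu rho nu) + (T nu rho mu - T nu mu rho)
      + (T rho mu nu - T rho nu mu)).
  rewrite -!TL -!big_split; apply: eq_bigr => b _ /=.
  by rewrite /torsion; move: (@pd R d) => D; ring.
have SR : \sum_(b < d) (curv w a b mu nu x * e b rho x + curv w a b nu rho x * e b mu x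
      + curv w a b rho mu x * e b nu x) =
    \sum_(b < d) ((pd mu (w a b nu) x - pd nu (w a b mu) x) * e b rho x
      + (pd nu (w a b rho) x - pd rho (w a b nu) x) * e b mu x
      + (pd rho (w a b mu) x - pd mu (w a b rho) x) * e b nu x)
    + ((T mu nu rho - T nu mu rho) + (T nu rho mu - T rho nu mu)
      + (T rho mu nu - T mu rho nu)).
  rewrite -!TR -!big_split; apply: eq_bigr => b _ /=.
  by rewrite /curv; move: (@pd R d) => D; ring.
rewrite SL SR !pd_torsion.
rewrite (pd_comm nu mu)// (pd_comm rho mu)// (pd_comm rho nu)//.
set S1 := \sum_(c < d) _; set S2 := \sum_(c < d) _; set S3 := \sum_(c < d) _.
set S4 := \sum_(c < d) _; set S5 := \sum_(c < d) _.
have : S1 + S2 + S3 + S4 - S5 = 0.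
  rewrite -!big_split -sumrB big1// => c _ /=.
  by move: (@pd R d) => D; ring.
clearbody S1 S2 S3 S4 S5; move: (@pd R d) => D S0.
by apply/eqP; rewrite -subr_eq0 -S0; apply/eqP; ring.
Qed.

End Torsion.

(** * Radial contractions in the Fock-Schwinger gauge *)

Section FockSchwinger.
Variables (R : realType) (d : nat).
Implicit Types (x : 'rV[R]_d) (a b c mu nu rho : 'I_d).
Variable w : connT R d.
Hypothesis sw : forall a b mu, smooth (w a b mu).
Hypothesis fs : fock_schwinger w.

Lemma coord_sum_comm n x (G : 'I_n -> 'I_d -> R) :
  (forall c : 'I_n, \sum_rho coord x rho * G c rho = 0) ->
  \sum_rho coord x rho * (\sum_c G c rho) = 0.
Proof.
move=> G0; under eq_bigr => rho _ do rewrite mulr_sumr.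
by rewrite exchange_big big1.
Qed.

(** The quadratic part contracts to zero because each of its terms contains [i_r w]. The rest is
    [i_r dw = L_r w], which is [E + 1] on components of a 1-form. *)
Lemma radial_curv a b nu x :
  \sum_mu coord x mu * curv w a b mu nu x = euler (w a b nu) x + w a b nu x.
Proof.
under eq_bigr do rewrite /curv mulrDr mulrBr.
rewrite big_split/= sumrB coord_sum_pd_of_coord_sum_eq0// opprK.
rewrite [X in _ + X]coord_sum_comm ?addr0// => c.
under eq_bigr do rewrite mulrBr mulrA mulrCA.
by rewrite sumrB -mulr_suml -mulr_sumr !fs mul0r mulr0 subr0.
Qed.

Lemma e_of_connE a mu x : e_of_conn w a mu x =
  kron R a mu + \sum_b coord x b * radial_int 1 (w a b mu) x.
Proof.
have cc b : continuous (fun t : R => t ^+ 1 * w a b mu (t *: x)).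
  exact: continuous_radial.
congr (_ + _); rewrite /radial_int; under eq_bigr do rewrite -int01Z//.
rewrite -int01_sum => [|b t]; last by apply: cvgM; [exact: cvg_cst|exact: cc].
apply: eq_int01 => t; apply: eq_bigr => b _; rewrite expr1; ring.
Qed.

Lemma smooth_e_of_conn a mu : smooth (e_of_conn w a mu).
Proof.
rewrite (_ : e_of_conn w a mu = fun x =>
    kron R a mu + \sum_b coord x b * radial_int 1 (w a b mu) x).
  apply: smoothD; first exact: smooth_cst.
  apply: smooth_sum => b; apply: smoothM; first exact: smooth_coord.
  exact: smooth_radial_int.
by apply/funext => x; exact: e_of_connE.
Qed.

(** The contraction passes under the integral, where it meets [i_r w = 0]; only the Kronecker term
    survives. *)
Lemma radial_e_of_conn a x : \sum_mu coord x mu * e_of_conn w a mu x = coord x a.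
Proof.
under eq_bigr do rewrite e_of_connE mulrDr.
rewrite big_split/= [X in _ + X]coord_sum_comm ?addr0 => [|b].
  rewrite -[RHS](sum_kron a (fun mu => coord x mu)); apply: eq_bigr => mu _.
  by rewrite mulrC /kron eq_sym.
under eq_bigr do rewrite mulrCA.
rewrite -mulr_sumr.
under eq_bigr do rewrite -radial_int_coordM//.
rewrite -radial_int_sum => [|mu]; last by apply: smoothM => //; exact: smooth_coord.
rewrite /radial_int (@eq_int01 _ _ (fun=> 0)) ?int01_cst ?mulr0// => t.
by rewrite fs mulr0.
Qed.

(** Since [(E + 1) x^b = x^b (E + 2)] as operators, the exponent 1 in the frame is the one inverted
    by [E + 2]. *)
Lemma euler_e_of_conn a nu x : euler (e_of_conn w a nu) x + e_of_conn w a nu x =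
  kron R a nu + \sum_b coord x b * w a b nu x.
Proof.
have sK b : smooth (radial_int 1 (w a b nu)) by exact: smooth_radial_int.
have sxK b : smooth (fun y => coord y b * radial_int 1 (w a b nu) y).
  by apply: smoothM => //; exact: smooth_coord.
rewrite (_ : euler _ x =
    \sum_b euler (fun y => coord y b * radial_int 1 (w a b nu) y) x); last first.
  rewrite /euler exchange_big; apply: eq_bigr => mu _.
  rewrite -mulr_sumr -pd_sum//; congr (_ * _).
  have -> : e_of_conn w a nu =
      fun y => kron R a nu + \sum_b coord y b * radial_int 1 (w a b nu) y.
    by apply/funext => y; exact: e_of_connE.
  rewrite pdD; [by rewrite pd_cst add0r|exact: smooth_cst|exact: smooth_sum].
rewrite e_of_connE addrCA; congr (_ + _); rewrite -big_split; apply: eq_bigr => b _ /=.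
rewrite euler_coordM// -(euler_radial_int 1 x (sw a b nu)); ring.
Qed.

(** [i_r T = L_r e - d(i_r e) + (i_r w) e - w (i_r e)]. With [i_r e^a = x^a] and [i_r w = 0] this is
    the difference of the two sides of [euler_e_of_conn]. *)
Lemma radial_torsion a nu x : \sum_mu coord x mu * torsion w (e_of_conn w) a mu nu x = 0.
Proof.
have se := smooth_e_of_conn.
under eq_bigr do rewrite /torsion mulrDr mulrBr.
rewrite big_split/= sumrB.
have -> : \sum_mu coord x mu * pd nu (e_of_conn w a mu) x =
    kron R a nu - e_of_conn w a nu x.
  have sk mu : smooth (fun _ : 'rV[R]_d => - kron R a mu) by exact: smooth_cst.
  (* Subtracting the Kronecker delta makes the contraction of the frame vanish, as
     [coord_sum_pd_of_coord_sum_eq0] requires. *)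
  rewrite -opprB -(@coord_sum_pd_of_coord_sum_eq0 _ _
    (fun mu y => e_of_conn w a mu y - kron R a mu)).
  - by apply: eq_bigr => mu _; rewrite pdD// pd_cst addr0.
  - by move=> mu; exact: smoothD.
  - move=> y; under eq_bigr do rewrite mulrBr.
    rewrite sumrB radial_e_of_conn -[X in X - _](sum_kron a (coord y)).
    by rewrite -sumrB big1// => mu _; rewrite /kron eq_sym; ring.
have -> : \sum_mu coord x mu * \sum_(b < d) (w a b mu x * e_of_conn w b nu x
      - w a b nu x * e_of_conn w b mu x) = - \sum_b coord x b * w a b nu x.
  under eq_bigr do rewrite mulr_sumr.
  rewrite exchange_big -sumrN; apply: eq_bigr => b _ /=.
  under eq_bigr do rewrite mulrBr mulrA [X in _ - X]mulrCA.
  by rewrite sumrB -mulr_suml fs mul0r -mulr_sumr radial_e_of_conn sub0r mulrC.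
have := euler_e_of_conn a nu x; rewrite /euler => H.
by apply: (addIr (kron R a nu + \sum_b coord x b * w a b nu x)); rewrite -{2}H; ring.
Qed.

Variable Rc : curvT R d.
Hypothesis radial_eq : forall a b nu x,
  \sum_mu coord x mu * Rc a b mu nu x = euler (w a b nu) x + w a b nu x.

(** Put [q = i_r R = (E + 1) w]. The factor [t] is absorbed into [q (t *: x)], so [t (1 - t)] leaves
    [K_0 q - K_1 q]. Here [K_0 q = w] and [K_1 q = K_1 (E + 2) w - K_1 w = w - K_1 w], and the
    difference is [K_1 w]. The hypothesis [radial_eq] holds for [curv w] as well as for
    [w = inv_map Rc], so both directions use this. *)
Lemma e_of_curv_eq : e_of_curv Rc = e_of_conn w.
Proof.
apply/funext => a; apply/funext => mu; apply/funext => x.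
rewrite e_of_connE; congr (_ + _).
pose q b y := euler (w a b mu) y + w a b mu y.
have sq b : smooth (q b) by apply: smoothD => //; exact: smooth_euler.
have c0 b := @continuous_radial _ _ 0 (q b) x (sq b).
have c1 b := @continuous_radial _ _ 1 (q b) x (sq b).
have c01 b : continuous (fun t : R => t ^+ 0 * q b (t *: x) - t ^+ 1 * q b (t *: x)).
  by move=> t; apply: cvgB; [exact: c0|exact: c1].
transitivity (\sum_b coord x b * (radial_int 0 (q b) x - radial_int 1 (q b) x)).
  rewrite /radial_int; under [RHS]eq_bigr do rewrite -int01B// -int01Z//.
  rewrite -int01_sum => [|b t]; last by apply: cvgM; [exact: cvg_cst|exact: c01].
  apply: eq_int01 => t; rewrite mulr_sumr; apply: eq_bigr => b _.
  have -> : \sum_nu coord x b * coord x nu * Rc a b nu mu (t *: x) =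
      coord x b * \sum_nu coord x nu * Rc a b nu mu (t *: x).
    by rewrite mulr_sumr; apply: eq_bigr => nu _; rewrite mulrA.
  have qE : q b (t *: x) = t * \sum_nu coord x nu * Rc a b nu mu (t *: x).
    rewrite /q -radial_eq mulr_sumr; apply: eq_bigr => nu _.
    by rewrite /coord mxE mulrA.
  by rewrite qE; move: (\sum_(_ < _) _) => S; ring.
apply: eq_bigr => b _; congr (_ * _).
have e0 := radial_int_euler 0 x (sw a b mu).
have e1 := radial_int_euler 1 x (sw a b mu).
rewrite (_ : radial_int 0 (q b) x = w a b mu x); last first.
  by rewrite -[RHS]e0; congr radial_int; apply/funext => y; rewrite /q mul1r.
rewrite -[X in X - _]e1 -radial_intB//; last first.
  apply: smoothD; first exact: smooth_euler.
  by apply: smoothM => //; exact: smooth_cst.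
by congr radial_int; apply/funext => y; rewrite /q; ring.
Qed.

End FockSchwinger.

(** * The inverse map as a radial integral *)

Section InverseMap.
Variables (R : realType) (d : nat).
Implicit Types (x : 'rV[R]_d) (a b c mu nu rho : 'I_d).
Variable Rc : curvT R d.
Hypothesis sRc : forall a b mu nu, smooth (Rc a b mu nu).

(** The factor [t] is absorbed into the coordinates of [t *: x], which leaves exponent 0. *)
Lemma inv_mapE a b mu : inv_map Rc a b mu =
  radial_int 0 (fun y => \sum_nu coord y nu * Rc a b nu mu y).
Proof.
apply/funext => x; apply: eq_int01 => t; rewrite expr0 mul1r mulr_sumr.
by apply: eq_bigr => nu _; rewrite /coord mxE mulrA.
Qed.

Lemma smooth_radial_contraction a b mu :
  smooth (fun y => \sum_nu coord y nu * Rc a b nu mu y).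
Proof. by apply: smooth_sum => nu; apply: smoothM => //; exact: smooth_coord. Qed.

Lemma smooth_inv_map a b mu : smooth (inv_map Rc a b mu).
Proof. by rewrite inv_mapE; exact/smooth_radial_int/smooth_radial_contraction. Qed.

Lemma euler_inv_map a b mu x :
  euler (inv_map Rc a b mu) x + inv_map Rc a b mu x = \sum_nu coord x nu * Rc a b nu mu x.
Proof.
rewrite inv_mapE -[RHS](euler_radial_int 0 x (smooth_radial_contraction a b mu)).
by rewrite mul1r.
Qed.

Lemma inv_map_eq (w : connT R d) : (forall a b mu, smooth (w a b mu)) ->
  (forall a b nu x,
    \sum_mu coord x mu * Rc a b mu nu x = euler (w a b nu) x + w a b nu x) ->
  inv_map Rc = w.
Proof.
move=> sw radial_eq; apply/funext => a; apply/funext => b; apply/funext => mu.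
apply/funext => x; rewrite inv_mapE -[RHS](radial_int_euler 0 x (sw a b mu)).
by congr radial_int; apply/funext => y; rewrite radial_eq mul1r.
Qed.

Hypothesis aRc : forall a b mu nu x, Rc a b mu nu x = - Rc a b nu mu x.

(** The symmetric [x^mu x^nu] is contracted with a curvature antisymmetric in its form indices, so
    the double sum equals its own opposite. *)
Lemma fock_schwinger_inv_map : fock_schwinger (inv_map Rc).
Proof.
move=> a b x; pose A mu nu := coord x mu * (coord x nu * radial_int 1 (Rc a b nu mu) x).
have E mu : coord x mu * inv_map Rc a b mu x = \sum_nu A mu nu.
  rewrite inv_mapE radial_int_sum => [|nu]; last first.
    by apply: smoothM => //; exact: smooth_coord.
  rewrite mulr_sumr; apply: eq_bigr => nu _.
  by rewrite radial_int_coordM.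
have aA mu nu : A mu nu = - A nu mu.
  rewrite /A (_ : Rc a b nu mu = fun y => -1 * Rc a b mu nu y).
    by rewrite radial_intZ//; ring.
  by apply/funext => y; rewrite aRc mulN1r.
under eq_bigr do rewrite E.
set S := \sum_(_ < _) _; have : S = - S.
  by rewrite {2}/S exchange_big -sumrN; apply: eq_bigr => mu _; rewrite -sumrN;
    apply: eq_bigr.
by move=> SN; lra.
Qed.

End InverseMap.

(** * The two directions of the bijection *)

Section Correspondence.
Variables (R : realType) (d : nat).
Implicit Types (w : connT R d) (Rc : curvT R d).

Lemma space_i_curv w : space_ii w -> space_i (curv w) /\ inv_map (curv w) = w.
Proof.
move=> [[aw sw] [fs tw]].
have sF := smooth_curv sw.
have rF := radial_curv sw fs.
have iF : inv_map (curv w) = w by exact: inv_map_eq.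
split=> //; split; first split; last split.
- move=> a b mu nu x; rewrite /curv.
  have wN m : w a b m = fun y => - w b a m y by apply/funext => y; exact: aw.
  rewrite !wN !pdN// !opprD -sumrN; congr (_ + _); apply: eq_bigr => c _.
  by rewrite (aw a c mu) (aw a c nu) (aw c b mu) (aw c b nu); ring.
- by split=> // a b mu nu x; exact: curv_antisym.
- move=> a mu nu rho x; have se := smooth_e_of_conn sw.
  have eE : e_of_curv (curv w) = e_of_conn w by exact: e_of_curv_eq.
  have T0 b m n : torsion w (e_of_conn w) b m n = fun=> 0 by apply/funext => y; exact: tw.
  (* The first Bianchi expression is the covariant derivative of a torsion that vanishes
     identically. *)
  rewrite eE -(cov_ext_torsion sw se) !T0 !pd_cst !add0r big1// => b _.
  by rewrite !T0 !mulr0 !addr0.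
- by move=> a b mu nu rho x; rewrite iF; exact: cov_ext_curv.
Qed.

Lemma curv_inv_map Rc : space_i Rc -> curv (inv_map Rc) = Rc.
Proof.
move=> [[_ [aRc sRc]] [_ b2]]; set w := inv_map Rc.
have sw : forall a b mu, smooth (w a b mu) by exact: smooth_inv_map.
have fs : fock_schwinger w by exact: fock_schwinger_inv_map.
have sF := smooth_curv sw.
have sN a b mu nu := smoothN (sRc a b mu nu).
pose D a b mu nu y := curv w a b mu nu y - Rc a b mu nu y.
have aD a b mu nu y : D a b mu nu y = - D a b nu mu y.
  by rewrite /D curv_antisym aRc opprB opprK addrC.
have rD a b nu y : \sum_mu coord y mu * D a b mu nu y = 0.
  under eq_bigr do rewrite mulrBr.
  by rewrite sumrB radial_curv// euler_inv_map// subrr.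
have rD' a b nu y : \sum_mu coord y mu * D a b nu mu y = 0.
  transitivity (- \sum_mu coord y mu * D a b mu nu y); last by rewrite rD oppr0.
  by rewrite -sumrN; apply: eq_bigr => mu _; rewrite aD mulrN.
have pD a b mu nu rho y :
    pd rho (D a b mu nu) y = pd rho (curv w a b mu nu) y - pd rho (Rc a b mu nu) y.
  by rewrite pdD// pdN.
apply/funext => a; apply/funext => b; apply/funext => m; apply/funext => n.
apply/funext => z; apply: subr0_eq; rewrite -[LHS]/(D a b m n z).
have sD c e mu nu : smooth (D c e mu nu) by exact: smoothD.
have DE c e mu nu y : D c e mu nu y = curv w c e mu nu y - Rc c e mu nu y by [].
clearbody D.
apply: (@radial_closed_eq0 _ _ (D a b)) => [//|mu nu y|nu y|mu nu y].
- exact: aD.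
- exact: rD.
(* The summand of [w /\ D - D /\ w]. Both curvatures satisfy the second Bianchi identity with the
   same [w], so by linearity [dD] is minus its sum. *)
pose G c rho := w a c mu y * D c b nu rho y + w a c nu y * D c b rho mu y
  + w a c rho y * D c b mu nu y - (D a c mu nu y * w c b rho y
  + D a c nu rho y * w c b mu y + D a c rho mu y * w c b nu y).
have GE rho : pd rho (D a b mu nu) y + pd mu (D a b nu rho) y + pd nu (D a b rho mu) y =
    \sum_c - G c rho.
  have e1 := cov_ext_curv sw a b mu nu rho y; rewrite /cov_ext in e1.
  have e2 := b2 a b mu nu rho y; rewrite -/w in e2.
  have -> : \sum_c - G c rho = - (
     (\sum_(c < d) (w a c mu y * curv w c b nu rho y + w a c nu y * curv w c b rho mu y
                  + w a c rho y * curv w c b mu nu y)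
      - \sum_(c < d) (curv w a c mu nu y * w c b rho y + curv w a c nu rho y * w c b mu y
                  + curv w a c rho mu y * w c b nu y))
     - (\sum_(c < d) (w a c mu y * Rc c b nu rho y + w a c nu y * Rc c b rho mu y
                  + w a c rho y * Rc c b mu nu y)
      - \sum_(c < d) (Rc a c mu nu y * w c b rho y + Rc a c nu rho y * w c b mu y
                  + Rc a c rho mu y * w c b nu y))).
    rewrite -!sumrB -sumrN; apply: eq_bigr => c _; rewrite /G !DE.
    by move: (curv w) => F; clear; ring.
  rewrite !pD; move: e1 e2; do 4!move: (\sum_(_ < _) _) => ?.
  by move: (@pd R d) (curv w) => P F; clear => e1 e2; lra.
under eq_bigr do rewrite GE.
apply: coord_sum_comm => c.
(* Regrouped so that every term carries a contraction of [D] or of [w] with [x], all of which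
   vanish. *)
transitivity (- \sum_rho (w a c mu y * (coord y rho * D c b nu rho y)
    + w a c nu y * (coord y rho * D c b rho mu y)
    + D c b mu nu y * (coord y rho * w a c rho y)
    - (D a c mu nu y * (coord y rho * w c b rho y)
    + w c b mu y * (coord y rho * D a c nu rho y)
    + w c b nu y * (coord y rho * D a c rho mu y)))).
  rewrite -sumrN; apply: eq_bigr => rho _; rewrite /G.
  by ring.
clear -rD rD' fs; clearbody w.
by rewrite sumrB !big_split/= -!mulr_sumr !rD !rD' !fs !mulr0 !addr0 subr0 oppr0.
Qed.

Lemma space_ii_inv_map Rc : space_i Rc -> space_ii (inv_map Rc).
Proof.
move=> hRc; have cE := curv_inv_map hRc.
move: hRc => [[abRc [aRc sRc]] [b1 _]]; set w := inv_map Rc in cE *.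
have sw : forall a b mu, smooth (w a b mu) by exact: smooth_inv_map.
have fs : fock_schwinger w by exact: fock_schwinger_inv_map.
split; first split=> //; last split=> //.
  move=> a b mu x; rewrite /w !inv_mapE.
  transitivity (radial_int 0 (fun y => -1 * \sum_nu coord y nu * Rc b a nu mu y) x).
    congr radial_int; apply/funext => y; rewrite mulN1r -sumrN.
    by apply: eq_bigr => nu _; rewrite abRc mulrN.
  by rewrite radial_intZ ?mulN1r//; exact: smooth_radial_contraction.
have se := smooth_e_of_conn sw.
have eE : e_of_curv Rc = e_of_conn w.
  by apply: e_of_curv_eq => // a b nu x; rewrite euler_inv_map.
pose T := torsion w (e_of_conn w).
have sT : forall a mu nu, smooth (T a mu nu) by exact: smooth_torsion.
have rT : forall a nu y, \sum_mu coord y mu * T a mu nu y = 0 by exact: radial_torsion.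
have aT : forall a mu nu y, T a mu nu y = - T a nu mu y by exact: torsion_antisym.
have cT a mu nu rho y : pd mu (T a nu rho) y + pd nu (T a rho mu) y + pd rho (T a mu nu) y
    + \sum_(b < d) (w a b mu y * T b nu rho y + w a b nu y * T b rho mu y
                    + w a b rho y * T b mu nu y) = 0.
  (* [cE] replaces the curvature of [w] by [Rc] and [eE] replaces the frame by that of [Rc], after
     which [b1] applies. *)
  by rewrite cov_ext_torsion// cE -eE b1.
move=> a m n z; rewrite -[LHS]/(T a m n z); clearbody T.
have rT' b nu y : \sum_mu coord y mu * T b nu mu y = 0.
  transitivity (- \sum_mu coord y mu * T b mu nu y); last by rewrite rT oppr0.
  by rewrite -sumrN; apply: eq_bigr => mu _; rewrite aT mulrN.
apply: (@radial_closed_eq0 _ _ (T a)) => // mu nu y.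
(* By [cT], [dT] is the sum of these terms. Each carries [T] or [w] with the index [rho], so
   contraction with [x^rho] kills it. *)
pose G b rho := - (w a b mu y * T b nu rho y + w a b nu y * T b rho mu y
  + w a b rho y * T b mu nu y).
have GE rho : pd rho (T a mu nu) y + pd mu (T a nu rho) y + pd nu (T a rho mu) y =
    \sum_b G b rho.
  have /eqP := cT a mu nu rho y; rewrite addr_eq0 sumrN => /eqP <-.
  by rewrite [RHS]addrC addrA.
under eq_bigr do rewrite GE.
apply: coord_sum_comm => b.
transitivity (- \sum_rho (w a b mu y * (coord y rho * T b nu rho y)
    + w a b nu y * (coord y rho * T b rho mu y)
    + T b mu nu y * (coord y rho * w a b rho y))).
  by rewrite -sumrN; apply: eq_bigr => rho _; rewrite /G; ring.
clear -rT rT' fs; clearbody w.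
by rewrite !big_split/= -!mulr_sumr rT rT' fs !mulr0 !addr0 oppr0.
Qed.

End Correspondence.

Theorem theorem1 (R : realType) (d : nat) :
  (forall w : connT R d, space_ii w ->
      space_i (curv w) /\ inv_map (curv w) = w) /\
  (forall Rc : curvT R d, space_i Rc ->
      space_ii (inv_map Rc) /\ curv (inv_map Rc) = Rc).
Proof.
split=> [w|Rc hRc]; first exact: space_i_curv.
by split; [exact: space_ii_inv_map|exact: curv_inv_map].
Qed.
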